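(* Let $\dot A$ be a densely defined closed symmetric operator with deficiency indices $(1,1)$ in a Hilbert space $\mathcal H$, with $(+)$-normalized deficiency vectors $g_\pm\in\operatorname{Ker}(\dot A^*\mp iI)$. Let $\Theta$ be an L-system with symmetric operator $\dot A$, main operator $T\neq T^*$ (a maximal dissipative extension of $\dot A$) and quasi-kernel $\hat A$ of $\operatorname{Re}\mathbb A$, such that $g_+-\kappa g_-\in\operatorname{Dom}(T)$ for some $0\le\kappa<1$ and $g_+-g_-\in\operatorname{Dom}(\hat A)$. Assume that $\Theta$ has finite c-Entropy $\mathcal S$. Then for every real $Q\neq0$ the c-Entropy $\mathcal S(Q)$ of the perturbed L-system $\Theta(Q)$ is finite and $$\mathcal S(Q)=\ln\frac{\left(b-2Q^2-\sqrt{b^2+4Q^2}\right)^2+a\left(b-\sqrt{b^2+4Q^2}\right)^2+4Q^2a(a+1)}{\left(b-2Q^2-\sqrt{b^2+4Q^2}\right)^2-a\left(b-\sqrt{b^2+4Q^2}\right)^2+4Q^2a(a-1)},$$ where $a=\tanh\left(\frac{\mathcal S}{2}\right)$ and $b=Q^2+a^2-1$.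
   Context: Rigged space: for a densely defined closed symmetric operator $\dot A$ in $\mathcal H$, let $\mathcal H_+=\operatorname{Dom}(\dot A^* )$ with inner product $(f,g)_+=(f,g)+(\dot A^*f,\dot A^*g)$, and let $\mathcal H_-$ be its dual, giving $\mathcal H_+\subset\mathcal H\subset\mathcal H_-$. $[\mathcal H_1,\mathcal H_2]$ denotes bounded linear operators from $\mathcal H_1$ to $\mathcal H_2$. If $\mathbb A\in[\mathcal H_+,\mathcal H_-]$ then $\mathbb A^*\in[\mathcal H_+,\mathcal H_-]$; put $\operatorname{Re}\mathbb A=\frac12(\mathbb A+\mathbb A^* )$, $\operatorname{Im}\mathbb A=\frac1{2i}(\mathbb A-\mathbb A^* )$. ''$(+)$-normalized'' means $\|g_\pm\|_+=1$ (note $\|g_\pm\|_+^2=2\|g_\pm\|^2$). An operator $T$ is dissipative if $\operatorname{Im}(Tf,f)\ge 0$ for all $f\in\operatorname{Dom}(T)$. $( * )$-extension: for $T$ with $\dot A\subset T\subset\dot A^*$, an operator $\mathbb A\in[\mathcal H_+,\mathcal H_-]$ is a $( * )$-extension of $T$ if $\dot A\subset T\subset\mathbb A$, $\dot A\subset T^*\subset\mathbb A^*$ and the quasi-kernel $\hat A$ of $\operatorname{Re}\mathbb A$, i.e. the restriction of $\operatorname{Re}\mathbb A$ to $\{f\in\mathcal H_+:(\operatorname{Re}\mathbb A)f\in\mathcal H\}$, is a self-adjoint extension of $\dot A$ in $\mathcal H$. L-system: given $\dot A$ with deficiency indices $(1,1)$ and a dissipative $T$ with $\dot A\subset T\subset\dot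 A^*$, an L-system $\Theta$ with symmetric operator $\dot A$ and main operator $T$ consists of the rigged space above, a $( * )$-extension $\mathbb A$ of $T$ (the state-space operator), and $K\in[\mathbb C,\mathcal H_-]$ with $K^*\in[\mathcal H_+,\mathbb C]$ and $\operatorname{Im}\mathbb A=KK^*$. Its transfer function is $W_\Theta(z)=I-2iK^*(\mathbb A-zI)^{-1}K$, $z\in\rho(T)$, and its impedance function is $V_\Theta(z)=K^*(\operatorname{Re}\mathbb A-zI)^{-1}K$; for $z\in\rho(T)$, $\operatorname{Im}z\ne0$, they are related by $V_\Theta(z)=i[W_\Theta(z)+I]^{-1}[W_\Theta(z)-I]$ and $W_\Theta(z)=(I+iV_\Theta(z))^{-1}(I-iV_\Theta(z))$. Perturbation: for $Q\in\mathbb R\setminus\{0\}$, the perturbed L-system $\Theta(Q)$ (the perturbation of $\Theta$) is an L-system with the same symmetric operator $\dot A$ as $\Theta$ whose impedance function satisfies the impedance shift formula $V_{\Theta(Q)}(z)=Q+V_\Theta(z)$. c-Entropy: the c-Entropy of an L-system $\Theta$ is $\mathcal S=-\ln|W_\Theta(-i)|$ (equal to $+\infty$ when $W_\Theta(-i)=0$). *)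

(* Defs.v *)
(* For [R : realType], [R[i]] is the field of complex numbers. *)
From HB Require Import structures.
From mathcomp Require Import all_boot all_order all_algebra.
From mathcomp Require Import all_classical all_reals all_analysis.
From mathcomp Require Import complex.

Set Implicit Arguments.
Unset Strict Implicit.
Unset Printing Implicit Defensive.

Import Order.TTheory GRing.Theory Num.Theory numFieldNormedType.Exports.
Import Normc.
Local Open Scope classical_set_scope.
Local Open Scope ring_scope.

(* A complex Hilbert space; [inner] is linear in its first argument and
   conjugate-linear in the second. *)
HB.mixin Record CompleteNormedModule_isHilbert (R : realType) H
    & CompleteNormedModule R[i] H := {
  inner : {dot H for (@Num.conj R[i])};
  normr_inner : forall x : H, `|x| ^+ 2 = inner x x
}.

#[short(type="hilbertType")]
HB.structure Definition Hilbert (R : realType) :=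
  {H of CompleteNormedModule_isHilbert R H & CompleteNormedModule R[i] H}.

Section UnboundedOperators.
Context {R : realType} {H : hilbertType R}.
Implicit Types A T : set (H * H).

(* An operator in [H] is represented by its graph: [A (f, g)] means that [f]
   lies in the domain and [A f = g]. Inclusion of graphs is operator
   extension, equality of graphs is equality of operators. *)
Definition linop A :=
  [/\ A (0, 0),
      forall (a : R[i]) x y, A x -> A y -> A (a *: x.1 + y.1, a *: x.2 + y.2)
    & forall f g g', A (f, g) -> A (f, g') -> g = g'].

Definition dom A : set H := [set f | exists g, A (f, g)].

Definition app A (f : H) : H := xget 0 [set g | A (f, g)].

(* For a densely defined [A] this is the graph of the operator A^*;
   in general it is a linear relation. *)
Definition adj A : set (H * H) :=
  [set y | forall x, A x -> inner x.2 y.1 = inner x.1 y.2].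

Definition symmetric_op A := A `<=` adj A.

Definition selfadjoint A := dense (dom A) /\ adj A = A.

Definition dissipative T := forall f g, T (f, g) -> 0 <= complex.Im (inner g f).

Definition maximal_dissipative T :=
  [/\ linop T, dissipative T
    & forall T', linop T' -> dissipative T' -> T `<=` T' -> T' = T].

(* Ker (A - z I) *)
Definition ker_sub A (z : R[i]) : set H := [set f | A (f, z *: f)].

Definition has_dim (V : set H) (n : nat) :=
  exists e : 'I_n -> H, (forall i, V (e i)) /\
    forall v, V v -> exists! c : 'rV[R[i]]_n, v = \sum_(i < n) c ord0 i *: e i.

Definition deficiency_indices A (m n : nat) :=
  has_dim (ker_sub (adj A) 'i) m /\ has_dim (ker_sub (adj A) (- 'i)) n.

End UnboundedOperators.

Section RiggedSpace.
Context {R : realType} {H : hilbertType R}.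

Definition Hplus (A : set (H * H)) : Type := set_type (dom (adj A)).

HB.instance Definition _ (A : set (H * H)) := SubChoice.on (Hplus A).

Fact dom_adj_submod_closed (A : set (H * H)) :
  submod_closed [pred f : H | f \in dom (adj A)].
Proof.
split; first by rewrite inE; exists 0 => x Ax; rewrite !linear0r.
move=> a f g; rewrite !inE => -[f' Af] [g' Ag].
exists (a *: f' + g') => x Ax /=.
by rewrite !linearPr /= Af // Ag.
Qed.

HB.instance Definition _ (A : set (H * H)) :=
  GRing.SubChoice_isSubLmodule.Build R[i] H
    [pred f : H | f \in dom (adj A)] (Hplus A) (dom_adj_submod_closed A).

Variable A : set (H * H).
Implicit Types (f g : Hplus A) (phi : Hplus A -> R[i]^o).

Definition inner_plus f g : R[i] :=
  inner (val f) (val g)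
  + inner (app (adj A) (val f)) (app (adj A) (val g)).

Definition norm_plus f : R := Num.sqrt (complex.Re (inner_plus f f)).

(* H_- consists of the bounded conjugate-linear functionals on H_+; the value
   [phi f] is the pairing (phi, f), which is linear in [phi]. *)
Definition Hminus : set (Hplus A -> R[i]^o) :=
  [set phi | linear_for (Num.conj \; *%R) phi /\
    exists M : R, forall f, normc (phi f) <= M * norm_plus f].

Definition norm_minus phi : R :=
  sup [set normc (phi f) | f in [set f | norm_plus f <= 1]].

(* The inclusion of H in H_-. *)
Definition embed (h : H) : Hplus A -> R[i]^o := fun f => inner h (val f).

(* [H_+, H_-] *)
Definition bounded_pm : set (Hplus A -> Hplus A -> R[i]^o) :=
  [set B | [/\ linear B, forall f, Hminus (B f)
    & exists M : R, forall f, norm_minus (B f) <= M * norm_plus f]].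

(* B^* is determined by (B f, g) = (f, B^* g). *)
Definition adj_pm (B : Hplus A -> Hplus A -> R[i]^o)
  : Hplus A -> Hplus A -> R[i]^o := fun f g => (B g f)^*.

Definition Re_pm (B : Hplus A -> Hplus A -> R[i]^o) := 2^-1 *: (B + adj_pm B).
Definition Im_pm (B : Hplus A -> Hplus A -> R[i]^o) :=
  (2 * 'i)^-1 *: (B - adj_pm B).

(* The restriction of B to {f in H_+ | B f in H}, as an operator in H. *)
Definition quasi_kernel (B : Hplus A -> Hplus A -> R[i]^o) : set (H * H) :=
  [set x | exists2 f : Hplus A, val f = x.1 & B f = embed x.2].

(* The inclusion of T in B means that B f = T f (in H_-) on Dom(T), that is,
   that T is contained in the quasi-kernel of B. *)
Definition star_extension (T : set (H * H))
    (B : Hplus A -> Hplus A -> R[i]^o) :=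
  [/\ bounded_pm B,
      A `<=` T /\ T `<=` quasi_kernel B,
      A `<=` adj T /\ adj T `<=` quasi_kernel (adj_pm B)
    & selfadjoint (quasi_kernel (Re_pm B)) /\ A `<=` quasi_kernel (Re_pm B)].

(* [C, H_-] *)
Definition bounded_Cm : set (R[i]^o -> Hplus A -> R[i]^o) :=
  [set K | [/\ linear K, forall c, Hminus (K c)
    & exists M : R, forall c, norm_minus (K c) <= M * normc c]].

(* K^* : H_+ -> C is determined by (K c, f) = c * (K^* f)^*; it is bounded
   because K 1 lies in H_-. *)
Definition adj_Cm (K : R[i]^o -> Hplus A -> R[i]^o) : Hplus A -> R[i]^o :=
  fun f => (K 1 f)^*.

(* K^* (B - z I)^-1 K in [C, C], identified with its value at 1: the number
   K^* f, where f in H_+ solves (B - z I) f = K 1 in H_-. The value is 0 by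
   convention when there is no solution. *)
Definition compressed_resolvent (B : Hplus A -> Hplus A -> R[i]^o)
    (K : R[i]^o -> Hplus A -> R[i]^o) (z : R[i]) : R[i] :=
  xget 0 [set w | exists2 f : Hplus A,
    B f - z *: embed (val f) = K 1 & w = adj_Cm K f].

End RiggedSpace.

Section LSystems.
Context {R : realType} {H : hilbertType R}.

Record Lsystem (A : set (H * H)) := MkLsystem {
  main_op : set (H * H);
  state_op : Hplus A -> Hplus A -> R[i]^o;
  channel : R[i]^o -> Hplus A -> R[i]^o;
  main_op_linop : linop main_op;
  main_op_dissipative : dissipative main_op;
  main_op_between : A `<=` main_op /\ main_op `<=` adj A;
  state_op_star_extension : star_extension main_op state_op;
  channel_bounded : bounded_Cm channel;
  Im_state_op : Im_pm state_op = channel \o adj_Cm channel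
}.

Variable A : set (H * H).
Implicit Type Theta : Lsystem A.

Definition transfer Theta (z : R[i]) : R[i] :=
  1 - 2 * 'i * compressed_resolvent (state_op Theta) (channel Theta) z.

Definition impedance Theta (z : R[i]) : R[i] :=
  compressed_resolvent (Re_pm (state_op Theta)) (channel Theta) z.

Definition perturbation (Q : R) Theta ThetaQ :=
  forall z : R[i], complex.Im z != 0 ->
    impedance ThetaQ z = Q%:C%C + impedance Theta z.

(* [lne] is -oo at 0, so the value is +oo when the transfer function vanishes
   at -i. *)
Definition c_entropy Theta : \bar R :=
  (- lne (normc (transfer Theta (- 'i)))%:E)%E.

End LSystems.

Definition tanh {R : realType} (x : R) : R :=
  (expR x - expR (- x)) / (expR x + expR (- x)).

(* Main.v *)
(* At z = -i the functions x = g+ - kappa g- and y = g+ - g- determine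
   everything: T x and Ahat y are known, Im (T x, x) = |K^* x|^2, and the
   symmetry of Re A gives (K^* y) (K^* x)^* = 1 - kappa. Since
   (A^* + i) (y - x) = 0, the multiple (y - x) / (i K^* x) solves
   (Re A + i) f = K 1, whence V(-i) = -i v with v = (1 - kappa) / (1 + kappa).
   Thus W(-i) = kappa and v = tanh (S / 2), while the shifted value Q - i v
   gives |W_Q(-i)|^2 = ((1 - v)^2 + Q^2) / ((1 + v)^2 + Q^2); the stated
   expression is the square root of the inverse of this ratio. *)
Require Import Defs.
From HB Require Import structures.
From mathcomp Require Import all_boot all_order all_algebra.
From mathcomp Require Import all_classical all_reals all_analysis.
From mathcomp Require Import complex ring lra.

Set Implicit Arguments.
Unset Strict Implicit.
Unset Printing Implicit Defensive.

Import Order.TTheory GRing.Theory Num.Theory numFieldNormedType.Exports.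
Local Open Scope classical_set_scope.
Local Open Scope ring_scope.

(** * Inner products and adjoints of densely defined operators *)

Section Inner.
Context {R : realType} {H : hilbertType R}.
Implicit Types (A : set (H * H)) (f g h : H).

Lemma innerC f g : inner f g = (inner g f)^*.
Proof. by have := hermC (@inner R H) f g; rewrite expr0 mul1r. Qed.

Lemma inner_eq0 f : (inner f f == 0) = (f == 0).
Proof. by rewrite -normr_inner sqrf_eq0 normr_eq0. Qed.

(** If [h] were nonzero, density would give [x] in [D] with [|h - x| < |h|], against Pythagoras:
    [|h - x|^2 = |h|^2 + |x|^2]. *)
Lemma dense_orthogonal (D : set H) h :
  dense D -> (forall x, D x -> inner x h = 0) -> h = 0.
Proof.
move=> Dd Dh; apply/eqP; apply: contraT => h0.
have ph : 0 < `|h| by rewrite normr_gt0.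
have [x [hx Dx]] : ball h `|h| `&` D !=set0.
  apply: Dd; last exact: ball_open.
  by exists h; apply: ballxx.
have E : inner (h - x) (h - x) = inner h h + inner x x.
  rewrite !linearBl /= !linearBr /= [inner h x]innerC (Dh _ Dx).
  by rewrite /= rmorph0 subr0 sub0r opprK.
move: hx; rewrite -ball_normE /= -(ltr_pXn2r (ltn0Sn 1)) ?nnegrE //.
by rewrite !normr_inner E gtrDl -normr_inner le_gtF ?exprn_ge0.
Qed.

Lemma adj_functional A f g g' :
  dense (dom A) -> adj A (f, g) -> adj A (f, g') -> g = g'.
Proof.
move=> Ad Ag Ag'; apply/eqP; rewrite -subr_eq0; apply/eqP.
apply: (dense_orthogonal Ad) => x [y Axy].
by rewrite linearBr /= -(Ag _ Axy) -(Ag' _ Axy) subrr.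
Qed.

Lemma app_adj A f g : dense (dom A) -> adj A (f, g) -> app (adj A) f = g.
Proof.
move=> Ad Afg; apply: xget_unique => // g' Ag'.
exact: adj_functional Ad Ag' Afg.
Qed.

Lemma adj_lin A (a : R[i]) f g f' g' :
  adj A (f, g) -> adj A (f', g') -> adj A (a *: f + f', a *: g + g').
Proof. by move=> Af Af' x Ax /=; rewrite !linearPr /= Af // Af'. Qed.

(** Since the eigenvalue has modulus 1, both summands of the graph inner product equal the squared
    norm in [H], which is therefore one half. *)
Lemma norm_plus_eigenvector A (g : Hplus A) (z : R[i]) :
  dense (dom A) -> ker_sub (adj A) z (val g) -> `|z| = 1 -> norm_plus g = 1 ->
  inner (val g) (val g) = 2^-1.
Proof.
move=> Ad Ag z1; rewrite /norm_plus /inner_plus (app_adj Ad Ag).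
rewrite linearZl_LR /= linearZr_LR /= mulrA -normCK z1 expr1n mul1r -mulr2n.
rewrite -normr_inner; set s := `|_| => ng.
have s_ge0 : 0 <= s ^+ 2 *+ 2 by rewrite mulrn_wge0 // exprn_ge0 // /s normr_ge0.
have sE : s ^+ 2 *+ 2 = (complex.Re (s ^+ 2 *+ 2))%:C%C.
  by rewrite RRe_real // ger0_real.
have : complex.Re (s ^+ 2 *+ 2) = 1.
  move: ng => /(congr1 (fun r => r ^+ 2)); rewrite expr1n sqr_sqrtr //.
  by rewrite -lecR -sE.
move=> rE; move: sE; rewrite rE -mulr_natr => sE.
by apply: (mulIf (x := 2)); rewrite ?pnatr_eq0 // mulVf ?pnatr_eq0.
Qed.

End Inner.

(** * Transfer and impedance functions computed from solutions of resolvent equations *)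

Section LSystems.
Context {R : realType} {H : hilbertType R} {A : set (H * H)}.
Implicit Types (Theta : Lsystem A) (f g : Hplus A) (z : R[i]).
Implicit Types (B : Hplus A -> Hplus A -> R[i]^o).
Implicit Types (K : R[i]^o -> Hplus A -> R[i]^o).

Lemma adj_Cm_linear K : bounded_Cm K -> linear (adj_Cm K : Hplus A -> R[i]^o).
Proof.
move=> [_ Km _] c f g; rewrite /adj_Cm.
have [Klin _] := Km 1.
have -> : K 1 (c *: f + g) = c^* * K 1 f + K 1 g := Klin c f g.
by rewrite rmorphD rmorphM /= conjCK.
Qed.

Lemma bounded_CmE K c f : bounded_Cm K -> K c f = c * (adj_Cm K f)^*.
Proof.
move=> [Klin _ _]; rewrite /adj_Cm conjCK.
have -> : K c = c *: K 1 by rewrite -(scalable_linear Klin) /= [c *: _]mulr1.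
by [].
Qed.

Lemma Re_pmE B f g : Re_pm B f g = 2^-1 * (B f g + (B g f)^*).
Proof. by []. Qed.

Lemma Im_pmE B f g : Im_pm B f g = (2 * 'i)^-1 * (B f g - (B g f)^*).
Proof. by []. Qed.

Lemma Re_pm_herm B f g : Re_pm B f g = (Re_pm B g f)^*.
Proof.
rewrite !Re_pmE rmorphM rmorphD /= conjCK fmorphV rmorph_nat.
by rewrite [(B g f)^* + _]addrC.
Qed.

Lemma Re_pm_linear B : bounded_pm B -> linear (Re_pm B).
Proof.
move=> [Blin Bm _] c f g; apply/funext => h.
have [Bhlin _] := Bm h.
have Bh : B h (c *: f + g) = c^* * B h f + B h g := Bhlin c f g.
have Bf : B (c *: f + g) h = c * B f h + B g h by rewrite Blin.
rewrite [RHS](_ : _ = c * Re_pm B f h + Re_pm B g h) //.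
rewrite !Re_pmE Bf Bh rmorphD rmorphM /= conjCK; ring.
Qed.

(** This is the relation Im A = K K^* read as an identity of sesquilinear forms: the imaginary part
    has rank one. *)
Lemma Im_state_opE Theta f g : let k := adj_Cm (channel Theta) in
  state_op Theta f g - (state_op Theta g f)^* = 2 * 'i * k f * (k g)^*.
Proof.
move=> k; have := congr1 (fun B => B f g) (Im_state_op Theta).
rewrite /= Im_pmE (bounded_CmE _ _ (channel_bounded Theta)) -/k -mulrA => <-.
by rewrite mulVKf // mulf_neq0 ?pnatr_eq0 ?neq0Ci.
Qed.

Lemma Re_state_opE Theta f g : let k := adj_Cm (channel Theta) in
  Re_pm (state_op Theta) f g = state_op Theta f g - 'i * k f * (k g)^*.
Proof.
move=> k; have E := Im_state_opE Theta f g.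
have -> : 'i * k f * (k g)^* =
    2^-1 * (state_op Theta f g - (state_op Theta g f)^*) by rewrite E; field.
by rewrite Re_pmE; field.
Qed.

(** [xget] picks an arbitrary solution. Two solutions differ by an element of the kernel of B - z I,
    so the value is well defined as soon as K^* vanishes on that kernel. *)
Lemma compressed_resolventE B K z f :
  linear B -> bounded_Cm K ->
  (forall g, B g = z *: embed (val g) -> adj_Cm K g = 0) ->
  B f - z *: embed (val f) = K 1 ->
  compressed_resolvent B K z = adj_Cm K f.
Proof.
move=> Blin Kb ker0 Bf; apply: xget_unique; first by exists f.
move=> w [g Bg ->].
have /eqP : adj_Cm K (g - f) = 0.
  apply: ker0; rewrite (zmod_morphism_linear Blin).
  have -> : B f = K 1 + z *: embed (val f) by rewrite -Bf subrK.
  have -> : B g = K 1 + z *: embed (val g) by rewrite -Bg subrK.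
  by apply/funext => h; rewrite !fctE /embed linearBl /GRing.scale /=; ring.
by rewrite (zmod_morphism_linear (adj_Cm_linear Kb)) subr_eq0 => /eqP.
Qed.

Lemma state_op_linear Theta : linear (state_op Theta).
Proof. by have [[]] := state_op_star_extension Theta. Qed.

Lemma Re_state_op_linear Theta : linear (Re_pm (state_op Theta)).
Proof. by apply: Re_pm_linear; have [] := state_op_star_extension Theta. Qed.

(** The form of Re A is Hermitian, so a kernel vector [g] satisfies [z (g, g) = z^* (g, g)], and a
    non-real [z] forces [g = 0]. *)
Lemma impedanceE Theta z f : 'Im z != 0 ->
  Re_pm (state_op Theta) f - z *: embed (val f) = channel Theta 1 ->
  impedance Theta z = adj_Cm (channel Theta) f.
Proof.
move=> z0; apply: compressed_resolventE; first exact: Re_state_op_linear.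
  exact: channel_bounded.
move=> g Bg; have g0 : val g = 0.
  apply/eqP; rewrite -inner_eq0; move: z0; apply: contra_neqT => g0.
  have := Re_pm_herm (state_op Theta) g g; rewrite Bg !fctE /embed /=.
  rewrite /GRing.scale /= rmorphM /= -innerC => /(mulIf g0) zE.
  by apply/Creal_ImP; rewrite CrealE -zE.
have -> : g = 0 *: 0 by rewrite scale0r; apply: val_inj; rewrite g0.
by rewrite (scalable_linear (adj_Cm_linear (channel_bounded Theta))) /= scale0r.
Qed.

(** For [g] in the kernel of A - z I, comparing imaginary parts gives [|K^* g|^2 = Im z (g, g)]. In
    the lower half-plane the right side is at most 0, so K^* g = 0. *)
Lemma transferE Theta z f : 'Im z < 0 ->
  state_op Theta f - z *: embed (val f) = channel Theta 1 ->
  transfer Theta z = 1 - 2 * 'i * adj_Cm (channel Theta) f.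
Proof.
move=> z_lt0 zf; congr (_ - _ * _); move: zf.
apply: compressed_resolventE; first exact: state_op_linear.
  exact: channel_bounded.
move=> g Bg; apply/eqP; rewrite -normr_eq0 -sqrf_eq0; apply/eqP/le_anti.
rewrite exprn_ge0 // andbT normCK.
have := Im_state_opE Theta g g; rewrite Bg !fctE /embed /=.
rewrite /GRing.scale /= rmorphM /= -innerC -mulrBl.
have -> : z - z^* = 2 * 'i * 'Im z.
  have i2 : 'i * 'i = -1 :> R[i] by rewrite -expr2 sqrCi.
  by rewrite ImE; field: i2.
rewrite -!mulrA => /(mulfI _) /(mulfI _) <-; rewrite ?pnatr_eq0 ?neq0Ci //.
by rewrite mulr_le0_ge0 ?(ltW z_lt0) // -normr_inner exprn_ge0.
Qed.

(** As A = Re A + i K K^*, the solution [f] for Re A satisfies (A - z I) f = (1 + iV) K 1. Rescaling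
    it by [c] gives the solution for A, hence W = 1 - 2iV / (1 + iV). *)
Lemma transfer_impedance Theta z f (V := adj_Cm (channel Theta) f) :
  'Im z < 0 ->
  Re_pm (state_op Theta) f - z *: embed (val f) = channel Theta 1 ->
  1 + 'i * V != 0 ->
  transfer Theta z = (1 - 'i * V) / (1 + 'i * V).
Proof.
move=> z_lt0 zf V0.
set c := (1 + 'i * V)^-1.
have KE : adj_Cm (channel Theta) (c *: f) = c * V.
  exact: scalable_linear (adj_Cm_linear (channel_bounded Theta)) c f.
rewrite (@transferE Theta z (c *: f)) // ?KE; first by rewrite /c; field.
apply/funext => h.
rewrite [LHS](_ : _ =
  state_op Theta (c *: f) h - z * inner (val (c *: f)) (val h)) //.
have -> : state_op Theta (c *: f) h = c * state_op Theta f h.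
  by rewrite (scalable_linear (state_op_linear Theta)).
have -> : inner (val (c *: f)) (val h) = c * inner (val f) (val h).
  exact: linearZl_LR.
have := congr1 (@^~ h) zf; rewrite /= !fctE /embed /= Re_state_opE.
rewrite (bounded_CmE _ _ (channel_bounded Theta)) /GRing.scale /= -/V mul1r.
move=> /eqP; rewrite !subr_eq => /eqP ->.
by rewrite /c; field.
Qed.

(** * The impedance function at -i from the deficiency vectors *)

Section Basis.
Variables (Theta : Lsystem A) (gp gm : Hplus A) (kappa : R).
Hypotheses (A_dense : dense (dom A))
  (gp_ker : ker_sub (adj A) 'i (val gp))
  (gm_ker : ker_sub (adj A) (- 'i) (val gm))
  (gp_normalized : norm_plus gp = 1) (gm_normalized : norm_plus gm = 1)
  (kappa_ge0 : 0 <= kappa) (kappa_lt1 : kappa < 1)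
  (T_dom : dom (main_op Theta) (val gp - kappa%:C%C *: val gm))
  (Ahat_dom :
     dom (quasi_kernel (Re_pm (state_op Theta))) (val gp - val gm)).

Let K0 := adj_Cm (channel Theta).
Let k := kappa%:C%C : R[i].
Let x : Hplus A := gp - k *: gm.
Let y : Hplus A := gp - gm.

Let adj_x : adj A (val x, 'i *: val gp + (k * 'i) *: val gm).
Proof.
have -> : val x = - k *: val gm + val gp by rewrite scaleNr addrC.
have -> : 'i *: val gp + (k * 'i) *: val gm =
    - k *: (- 'i *: val gm) + 'i *: val gp by rewrite scalerA mulrNN addrC.
exact: adj_lin.
Qed.

(** T lies both in the adjoint of [A], which determines the value T x, and in the quasi-kernel of
    the state-space operator, which carries this value over to [state_op]. *)
Let state_op_x : state_op Theta x = embed ('i *: val gp + (k * 'i) *: val gm).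
Proof.
have [g Tg] := T_dom.
have [_ TA] := main_op_between Theta.
have [_ [_ /(_ _ Tg) [f fE Bf]] _ _] := state_op_star_extension Theta.
have -> : x = f by apply: val_inj.
by rewrite Bf (adj_functional A_dense (TA _ Tg) adj_x).
Qed.

Let adj_y : adj A (val y, 'i *: val gp + 'i *: val gm).
Proof.
have -> : val y = - 1 *: val gm + val gp by rewrite scaleN1r addrC.
have -> : 'i *: val gp + 'i *: val gm =
    - 1 *: (- 'i *: val gm) + 'i *: val gp by rewrite scalerA mulrNN mul1r addrC.
exact: adj_lin.
Qed.

Let Re_state_op_y :
  Re_pm (state_op Theta) y = embed ('i *: val gp + 'i *: val gm).
Proof.
have [_ _ _ [[_ sa] AA]] := state_op_star_extension Theta.
have [g Ag] := Ahat_dom; have [f fE Bf] := Ag.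
(* The quasi-kernel is self-adjoint and extends [A], hence is contained in the adjoint of [A]. *)
have Ag' : adj A (val gp - val gm, g).
  by move: Ag; rewrite -sa => + z Az; apply; apply: AA.
have -> : y = f by apply: val_inj.
by rewrite Bf (adj_functional A_dense Ag' adj_y).
Qed.

Let gpE : inner (val gp) (val gp) = 2^-1.
Proof. by apply: norm_plus_eigenvector gp_ker _ gp_normalized; rewrite ?normCi. Qed.
Let gmE : inner (val gm) (val gm) = 2^-1.
Proof.
by apply: norm_plus_eigenvector gm_ker _ gm_normalized; rewrite ?normrN ?normCi.
Qed.

Let kC : k^* = k.
Proof. by apply: conj_Creal; rewrite complex_real. Qed.

Let m := inner (val gp) (val gm).

(** The two deficiency vectors need not be orthogonal in [H]; their inner product [m] is kept as a
    parameter and cancels in [K_x] and [K_xy]. *)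
Let inner_comb (a b c d : R[i]) :
  inner (a *: val gp + b *: val gm) (c *: val gp + d *: val gm) =
  (a * c^* + b * d^*) / 2 + a * d^* * m + b * c^* * m^*.
Proof.
have Zl u v w : inner (u *: v : H) w = u * inner v w by exact: linearZl_LR.
have Zr u v w : inner v (u *: w : H) = u^* * inner v w by exact: linearZr_LR.
rewrite linearDl /= !linearDr /= !Zl !Zr gpE gmE -/m [inner (val gm) _]innerC -/m.
by field.
Qed.

Let xE : val x = 1 *: val gp + (- k) *: val gm.
Proof. by rewrite scale1r scaleNr. Qed.

Let yE : val y = 1 *: val gp + (- 1) *: val gm.
Proof. by rewrite scale1r scaleN1r. Qed.

Let i2 : 'i * 'i = -1 :> R[i]. Proof. by rewrite -expr2 sqrCi. Qed.

Let K_x : K0 x * (K0 x)^* = (1 - k ^+ 2) / 2.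
Proof.
have i0 := neq0Ci R[i].
have := Im_state_opE Theta x x; rewrite state_op_x /embed xE inner_comb -/K0.
move: (K0 x) => p.
rewrite !(rmorphD, rmorphM, rmorphN, rmorph1, fmorphV, rmorph_nat) /= !conjCK conjCi kC.
move=> E; apply: (mulfI (x := 2 * 'i)); first by rewrite mulf_neq0 ?pnatr_eq0.
by rewrite (mulrA _ p) -E; field.
Qed.

Let K_xy : K0 y * (K0 x)^* = 1 - k.
Proof.
have i0 := neq0Ci R[i].
have := Re_pm_herm (state_op Theta) y x.
rewrite Re_state_op_y (Re_state_opE Theta x) state_op_x /embed xE yE !inner_comb -/K0.
move: (K0 x) (K0 y) => p q.
rewrite !(rmorphD, rmorphM, rmorphN, rmorphB, rmorph1, fmorphV, rmorph_nat) /= !conjCK conjCi kC.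
move=> /eqP; rewrite -subr_eq0 => /eqP E; apply: (mulfI i0); apply/eqP.
by rewrite -subr_eq0 -oppr_eq0; apply/eqP; apply: etrans E; field.
Qed.

Lemma impedance_solution : exists2 f,
  Re_pm (state_op Theta) f - (- 'i) *: embed (val f) = channel Theta 1
  & K0 f = - 'i * ((1 - kappa) / (1 + kappa))%:C%C.
Proof.
have i0 := neq0Ci R[i].
have k1 : 1 + k != 0.
  have -> : 1 + k = (1 + kappa)%:C%C by rewrite rmorphD rmorph1.
  by rewrite (inj_eq (@complexI R) _ 0) gt_eqF // ltr_pwDl.
have k2 : 1 - k != 0.
  have -> : 1 - k = (1 - kappa)%:C%C by rewrite rmorphB rmorph1.
  by rewrite (inj_eq (@complexI R) _ 0) gt_eqF // subr_gt0.
(* Here [0 <= kappa < 1] ensures that K^* x can be divided by. *)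
have pp0 : K0 x * (K0 x)^* != 0.
  rewrite K_x mulf_neq0 ?invr_eq0 ?pnatr_eq0 //.
  by rewrite (_ : _ - _ = (1 - k) * (1 + k)) ?mulf_neq0 //; ring.
have : (K0 x != 0) && ((K0 x)^* != 0) by rewrite -negb_or -mulf_eq0.
move=> /andP[p0 pc0].
(* The vector [y - x] is a multiple of [gm], so the adjoint of [A] acts on it as -i. Since Re A x =
   A x - i (K^* x) K 1, applying Re A + i to [y - x] leaves exactly i (K^* x) K 1. *)
pose c := ('i * K0 x)^-1.
have Klin := adj_Cm_linear (channel_bounded Theta).
have Rlin := Re_state_op_linear Theta.
exists (c *: (y - x)).
  apply/funext => h.
  have yx : val (y - x) = (k - 1) *: val gm.
    rewrite -[LHS]/(val gp - val gm - (val gp - k *: val gm)).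
    by rewrite scalerBl scale1r opprB addrC addrA subrK.
  have -> : Re_pm (state_op Theta) (c *: (y - x)) = c *:
      (Re_pm (state_op Theta) y - Re_pm (state_op Theta) x).
    by rewrite (scalable_linear Rlin) (zmod_morphism_linear Rlin).
  have -> : val (c *: (y - x)) = (c * (k - 1)) *: val gm by rewrite -scalerA -yx.
  rewrite scaleNr opprK Re_state_op_y.
  rewrite [LHS](_ : _ = c * (inner ('i *: val gp + 'i *: val gm) (val h) -
    Re_pm (state_op Theta) x h) + 'i * inner ((c * (k - 1)) *: val gm) (val h)) //.
  rewrite Re_state_opE state_op_x /embed !linearDl /= !linearZl_LR /=.
  rewrite (bounded_CmE _ _ (channel_bounded Theta)) -/K0.
  by rewrite /c /GRing.scale /=; field; rewrite p0 i0.
rewrite [K0 _](scalable_linear Klin) (zmod_morphism_linear Klin) -/K0 /c.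
have -> : ((1 - kappa) / (1 + kappa))%:C%C = (1 - k) / (1 + k).
  by rewrite fmorph_div rmorphB rmorphD rmorph1.
(* Both values are written over the conjugate of K^* x, so that its undetermined phase drops out of
   the quotient (K^* y) / (K^* x). *)
have pE : K0 x = (1 - k) * (1 + k) / 2 / (K0 x)^*.
  by apply: (canRL (mulfK pc0)); rewrite K_x; field.
have qE : K0 y = (1 - k) / (K0 x)^* by apply: (canRL (mulfK pc0)); exact: K_xy.
move: ((K0 x)^*) pc0 pE qE => pc pc0 -> ->.
rewrite invfM invCi; set u := _ / _; set v := _ - _.
rewrite [LHS](_ : _ = u * v) // /u /v.
by field; rewrite pc0 k1 k2.
Qed.

End Basis.

(** The default value of [compressed_resolvent] is 0, so a nonzero value certifies that the equation
    is solvable. This yields a solution for the perturbed system, where no explicit vector is at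
    hand. *)
Lemma impedance_neq0_solution Theta z : impedance Theta z != 0 ->
  exists2 f, Re_pm (state_op Theta) f - z *: embed (val f) = channel Theta 1
    & impedance Theta z = adj_Cm (channel Theta) f.
Proof.
rewrite /impedance /compressed_resolvent; case: xgetP => [w -> [f]|_].
  by exists f.
by rewrite eqxx.
Qed.

End LSystems.

(** * Real identities behind the closed formula *)

Section RealIdentity.
Context {R : realType}.
Implicit Types a Q : R.

(** The numerator factors as [2 p s] and the denominator as [2 m t], where [p s^2 = m t^2]; hence
    the square of the quotient is [p / m]. *)
Lemma entropy_shift a Q : 0 < a -> a < 1 -> Q != 0 ->
  let b := Q ^+ 2 + a ^+ 2 - 1 in
  let r := Num.sqrt (b ^+ 2 + 4 * Q ^+ 2) in
  Num.sqrt ((1 + a) ^+ 2 + Q ^+ 2) / Num.sqrt ((1 - a) ^+ 2 + Q ^+ 2) =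
    ((b - 2 * Q ^+ 2 - r) ^+ 2 + a * (b - r) ^+ 2 + 4 * Q ^+ 2 * a * (a + 1))
    / ((b - 2 * Q ^+ 2 - r) ^+ 2 - a * (b - r) ^+ 2 + 4 * Q ^+ 2 * a * (a - 1)).
Proof.
move=> a_gt0 a_lt1 Q0 b r.
have Q2 : 0 < Q ^+ 2 by rewrite exprn_even_gt0.
set p := (1 + a) ^+ 2 + Q ^+ 2; set m := (1 - a) ^+ 2 + Q ^+ 2.
have p_gt0 : 0 < p by rewrite ltr_wpDl ?sqr_ge0.
have m_gt0 : 0 < m by rewrite ltr_wpDl ?sqr_ge0.
have rr : r ^+ 2 = b ^+ 2 + 4 * Q ^+ 2.
  by rewrite sqr_sqrtr // addr_ge0 ?sqr_ge0 // mulr_ge0 // ltW.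
have br : b < r.
  apply: le_lt_trans (ler_norm b) _; rewrite -sqrtr_sqr ltr_sqrt.
    by rewrite ltrDl mulr_gt0.
  by rewrite ltr_wpDl ?sqr_ge0 // mulr_gt0.
(* From here on [r] enters only through its square and through [b < r], which makes [s] and [t]
   positive. *)
clearbody r.
have -> : (b - 2 * Q ^+ 2 - r) ^+ 2 + a * (b - r) ^+ 2 + 4 * Q ^+ 2 * a * (a + 1)
    = 2 * p * (2 * Q ^+ 2 + (1 - a) * (r - b)).
  by rewrite /p /b in rr *; ring: rr.
have -> : (b - 2 * Q ^+ 2 - r) ^+ 2 - a * (b - r) ^+ 2 + 4 * Q ^+ 2 * a * (a - 1)
    = 2 * m * (2 * Q ^+ 2 + (1 + a) * (r - b)).
  by rewrite /m /b in rr *; ring: rr.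
set s := _ + (1 - a) * _; set t := _ + (1 + a) * _.
have rb_gt0 : 0 < r - b by rewrite subr_gt0.
have s_gt0 : 0 < s by rewrite /s; nra.
have t_gt0 : 0 < t by rewrite /t; nra.
have st : p * s ^+ 2 = m * t ^+ 2.
  by rewrite /s /t /p /m /b in rr *; ring: rr.
apply: (pexpIrn (ltn0Sn 1)).
- by rewrite nnegrE divr_ge0 ?sqrtr_ge0.
- by rewrite nnegrE divr_ge0 ?mulr_ge0 ?ltW.
rewrite expr_div_n !sqr_sqrtr ?ltW //.
have -> : p = m * t ^+ 2 / s ^+ 2.
  by apply: (canRL (mulfK _)); rewrite ?expf_neq0 ?gt_eqF.
by field; rewrite ?gt_eqF.
Qed.

(** This is the shape of [v] with [kappa] replaced by [expR (- x)], which identifies [a] with [v] in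
    the theorem. *)
Lemma tanh_half (x : R) : tanh (x / 2) = (1 - expR (- x)) / (1 + expR (- x)).
Proof.
rewrite /tanh.
have -> : expR (- x) = expR (- (x / 2)) * expR (- (x / 2)).
  by rewrite -expRD; congr expR; field.
rewrite expRN; have := expR_gt0 (x / 2); move: (expR _) => e e0.
by field; rewrite !gt_eqF // addr_gt0 ?mulr_gt0.
Qed.

End RealIdentity.

Theorem theorem7 (R : realType) (H : hilbertType R) (A : set (H * H))
    (A_linop : linop A) (A_dense : dense (dom A)) (A_closed : closed A)
    (A_symmetric : symmetric_op A) (A_deficiency : deficiency_indices A 1 1)
    (gp gm : Hplus A)
    (gp_ker : ker_sub (adj A) 'i (val gp))
    (gm_ker : ker_sub (adj A) (- 'i) (val gm))
    (gp_normalized : norm_plus gp = 1) (gm_normalized : norm_plus gm = 1)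
    (Theta : Lsystem A)
    (T_maximal : maximal_dissipative (main_op Theta))
    (T_not_selfadjoint : main_op Theta <> adj (main_op Theta))
    (kappa : R) (kappa_ge0 : 0 <= kappa) (kappa_lt1 : kappa < 1)
    (T_dom : dom (main_op Theta) (val gp - kappa%:C%C *: val gm))
    (Ahat_dom :
      dom (quasi_kernel (Re_pm (state_op Theta))) (val gp - val gm))
    (S : R) (S_entropy : c_entropy Theta = S%:E)
    (Q : R) (Q_neq0 : Q != 0)
    (ThetaQ : Lsystem A) (ThetaQ_perturbation : perturbation Q Theta ThetaQ) :
  let a := tanh (S / 2) in
  let b := Q ^+ 2 + a ^+ 2 - 1 in
  let r := Num.sqrt (b ^+ 2 + 4 * Q ^+ 2) in
  c_entropy ThetaQ =
    (ln (((b - 2 * Q ^+ 2 - r) ^+ 2 + a * (b - r) ^+ 2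
            + 4 * Q ^+ 2 * a * (a + 1))
         / ((b - 2 * Q ^+ 2 - r) ^+ 2 - a * (b - r) ^+ 2
            + 4 * Q ^+ 2 * a * (a - 1))))%:E.
Proof.
have Imi : 'Im (- 'i : R[i]) < 0 by rewrite raddfN /= Im_i oppr_lt0.
have [f Rf] := impedance_solution A_dense gp_ker gm_ker gp_normalized
  gm_normalized kappa_ge0 kappa_lt1 T_dom Ahat_dom.
set v := (1 - kappa) / (1 + kappa) => fE.
have k1 : 0 < 1 + kappa by rewrite ltr_pwDl.
have v1 : 0 < 1 + v by rewrite ltr_wpDr // divr_ge0 ?subr_ge0 ?ltW.
have i2 : 'i * 'i = -1 :> R[i] by rewrite -expr2 sqrCi.
have iV (w : R[i]) : 'i * (- 'i * w) = w by rewrite mulrA mulrN i2 opprK mul1r.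
(* With iV = [v], the map sending [v] to [(1 - v) / (1 + v)] is an involution and returns
   [kappa]. *)
have W : transfer Theta (- 'i) = kappa%:C%C.
  rewrite (transfer_impedance Imi Rf) fE iV -!(rmorph1 (real_complex R)).
    rewrite -rmorphB -rmorphD -fmorph_div /=; congr _%:C%C.
    rewrite /v; field; rewrite !gt_eqF //; lra.
  by rewrite -rmorphD (inj_eq (@complexI R) _ 0) gt_eqF.
have kS : kappa = expR (- S).
  have normc_kappa : Normc.normc kappa%:C%C = kappa.
    by rewrite /= expr0n addr0 sqrtr_sqr ger0_norm.
  move: S_entropy; rewrite /c_entropy W normc_kappa.
  (* For [kappa = 0] the entropy would be infinite, which its finite value [S] excludes. *)
  have [k0|k0] := leP kappa 0; first by rewrite le0_lneNy ?lee_fin.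
  by rewrite lne_EFin // -EFinN => -[<-]; rewrite opprK lnK.
have k0 : 0 < kappa by rewrite kS expR_gt0.
move=> a b r.
have av : a = v by rewrite /a tanh_half -kS.
have a0 : 0 < a by rewrite av divr_gt0 // subr_gt0.
have a1 : a < 1 by rewrite av ltr_pdivrMr // mul1r; lra.
rewrite -(entropy_shift a0 a1 Q_neq0).
have VQ : impedance ThetaQ (- 'i) = Q%:C%C - 'i * v%:C%C.
  rewrite ThetaQ_perturbation; last by rewrite -complexiE /= oppr_eq0 oner_eq0.
  congr (_ + _); rewrite -mulNr -fE; apply: impedanceE Rf.
  by rewrite lt_eqF.
(* The real part of the shifted value is [Q], so this value is nonzero and is not the default. *)
have [|g Rg gE] := @impedance_neq0_solution _ _ _ ThetaQ (- 'i).
  rewrite VQ -complexiE eq_complex /= negb_and.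
  by rewrite mul0r mul1r !subr0 Q_neq0.
have iVQ : 'i * (Q%:C%C - 'i * v%:C%C) = (v +i* Q)%C.
  rewrite -complexiE; apply/eqP; rewrite eq_complex /=.
  by apply/andP; split; apply/eqP; ring.
(* The imaginary part is [Q], so the relation between W and V applies to the perturbed system. *)
have den_neq0 : 1 + (v +i* Q)%C != 0.
  by rewrite eq_complex /= add0r negb_and Q_neq0 orbT.
have WQ : transfer ThetaQ (- 'i) = ((1 - a) -i* Q)%C / ((1 + a) +i* Q)%C.
  rewrite (transfer_impedance Imi Rg) -gE VQ iVQ // av.
  by congr (_ / _); apply/eqP; rewrite eq_complex /= ?add0r ?sub0r !eqxx.
have normc_gt0 (p : R) : 0 < Num.sqrt (p ^+ 2 + Q ^+ 2).
  by rewrite sqrtr_gt0 ltr_wpDl ?sqr_ge0 // exprn_even_gt0.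
rewrite /c_entropy WQ.
have -> : Normc.normc (((1 - a) -i* Q)%C / ((1 + a) +i* Q)%C) =
    Num.sqrt ((1 - a) ^+ 2 + Q ^+ 2) / Num.sqrt ((1 + a) ^+ 2 + Q ^+ 2).
  by rewrite Normc.normcM Normc.normcV /= sqrrN.
rewrite lne_EFin ?divr_gt0 // -EFinN; congr _%:E.
by rewrite -lnV ?posrE ?divr_gt0 // invf_div.
Qed.
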